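(* The following hold. (i) If $0\le\alpha<\beta\le1$, then $H_\beta\preceq H_\alpha$. (ii) If $0\le\alpha<\beta\le2$, then $G_\beta\preceq G_\alpha$. (iii) If $0\le\alpha<\beta\le1$, then $A_\alpha\preceq A_\beta$.
   Context: For $x,y>0$ with $x\ne y$ and $\alpha>0$ put $$A_\alpha(x,y)=\frac{\alpha(x^\alpha+y^\alpha)(x-y)}{2(x^\alpha-y^\alpha)}\ (\alpha\le1),\quad G_\alpha(x,y)=\frac{\alpha (xy)^{\alpha/2}(x-y)}{x^\alpha-y^\alpha}\ (\alpha\le2),\quad H_\alpha(x,y)=\frac{2\alpha(xy)^\alpha}{x^\alpha+y^\alpha}\cdot\frac{x-y}{x^\alpha-y^\alpha}\ (\alpha\le1).$$ For $\alpha=0$ set $A_0(x,y)=G_0(x,y)=H_0(x,y)=\frac{x-y}{\log x-\log y}$ (the limits as $\alpha\to0$). All these functions equal $x$ when $x=y$. For two such means $M,N$, the notation $M\preceq N$ means that the function $t\mapsto M(e^t,1)/N(e^t,1)$ is positive definite on $\mathbb{R}$. Here a real continuous function $\phi$ on $\mathbb{R}$ is positive definite if for all $n\in\mathbb{N}$ and $t_1,\dots,t_n\in\mathbb{R}$ the matrix $[\phi(t_i-t_j)]_{i,j=1}^n$ is positive semidefinite. *)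

(* Defs.v *)
From mathcomp Require Import all_boot all_order all_algebra.
From mathcomp Require Import all_classical all_reals all_analysis.

Set Implicit Arguments.
Unset Strict Implicit.
Unset Printing Implicit Defensive.

Import Order.TTheory GRing.Theory Num.Theory.
Import numFieldNormedType.Exports.

Local Open Scope ring_scope.

(* The logarithmic mean off the diagonal; the value at [x = y] is fixed below. *)
Definition log_mean (R : realType) (x y : R) : R :=
  (x - y) / (ln x - ln y).

(* The functions of [x, y] below are meant for [0 < x] and [0 < y]. The
   parameter [a] is meant in [0, 1] for [mean_A] and [mean_H], and in [0, 2]
   for [mean_G]; values outside these ranges are irrelevant. *)
Definition mean_A (R : realType) (a x y : R) : R :=
  if x == y then x
  else if a == 0 then log_mean x y
  else (a * (x `^ a + y `^ a) * (x - y)) / (2 * (x `^ a - y `^ a)).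

Definition mean_G (R : realType) (a x y : R) : R :=
  if x == y then x
  else if a == 0 then log_mean x y
  else (a * (x * y) `^ (a / 2) * (x - y)) / (x `^ a - y `^ a).

Definition mean_H (R : realType) (a x y : R) : R :=
  if x == y then x
  else if a == 0 then log_mean x y
  else (2 * a * (x * y) `^ a) / (x `^ a + y `^ a)
       * ((x - y) / (x `^ a - y `^ a)).

Definition psdmx (R : realType) (n : nat) (A : 'M[R]_n) : Prop :=
  A^T = A /\ forall v : 'cV[R]_n, 0 <= (v^T *m A *m v) ord0 ord0.

Definition positive_definite (R : realType) (phi : R -> R) : Prop :=
  continuous phi /\
  forall (n : nat) (t : 'I_n -> R),
    psdmx (\matrix_(i < n, j < n) phi (t i - t j)).

Definition mean_preceq (R : realType) (M N : R -> R -> R) : Prop :=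
  positive_definite (fun t : R => M (expR t) 1 / N (expR t) 1).

Notation "M ⪯ N" := (mean_preceq M N) (at level 70, no associativity).

(* Main.v *)
(** At [(e^t, 1)] the means [H_a], [G_a], [A_a] are the logarithmic mean divided
    by [sinhc (a t)], [sinhc (a t / 2)], [tanhc (a t / 2)] respectively, where
    [sinhc t = sinh t / t] and [tanhc t = tanh t / t]; so one needs that
    [sinhc (a t) / sinhc (b t)] and [tanhc (b t) / tanhc (a t)] are positive
    definite for [0 <= a < b].  No Fourier transform is used: for
    [r_n = sinh (n t) / sinh ((n + 1) t)] one has
    [r_(n+1) = 1 / (2 cosh t - r_n)], which expands as a geometric series in
    positive definite functions; products and limits then give all ratios of
    [sinhc].  For [tanhc] the ratio is, up to a constant,
    [1 + sinh ((b - a) t) / (sinh (a t) cosh (b t))], which reduces to the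
    first case when [b <= 2 a]; larger quotients are reached by doubling, and
    [a = 0] by a limit. *)
Require Import Defs.
From mathcomp Require Import all_boot all_order all_algebra.
From mathcomp Require Import all_classical all_reals all_analysis.
From mathcomp Require Import ring lra.
Set Implicit Arguments.
Unset Strict Implicit.
Unset Printing Implicit Defensive.

Import Order.TTheory GRing.Theory Num.Theory.
Import numFieldNormedType.Exports.
Local Open Scope classical_set_scope.
Local Open Scope ring_scope.

(** * Positive semidefinite kernels on a finite index set *)

Section PositiveSemidefinite.
Context {R : realType} {n : nat}.
Implicit Types (A B : 'I_n -> 'I_n -> R) (c a : 'I_n -> R).

Definition qform A c : R := \sum_i c i * \sum_j c j * A i j.

Definition psd A : Prop :=
  (forall i j, A i j = A j i) /\ forall c, 0 <= qform A c.

Lemma sum_shift c s k (F : 'I_n -> R) :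
  \sum_j (c j + s * (j == k)%:R) * F j = \sum_j c j * F j + s * F k.
Proof.
under eq_bigr do rewrite mulrDl.
rewrite big_split /=; congr (_ + _).
rewrite (bigD1 k)//= eqxx mulr1 big1 ?addr0// => j /negPf ->.
by rewrite mulr0 mul0r.
Qed.

(** Varying one coordinate makes the form a quadratic polynomial in [s]; suitable values of [s] give
    the diagonal facts and the elimination step below. *)
Lemma qform_shift A c s k : (forall i j, A i j = A j i) ->
  qform A (fun i => c i + s * (i == k)%:R) =
  qform A c + 2 * s * (\sum_i c i * A i k) + s ^+ 2 * A k k.
Proof.
move=> sA; rewrite /qform sum_shift sum_shift.
under eq_bigr do rewrite sum_shift mulrDr.
rewrite big_split /=.
have -> : \sum_i c i * (s * A i k) = s * \sum_i c i * A i k.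
  by rewrite mulr_sumr; apply: eq_bigr => i _; ring.
have -> : \sum_j c j * A k j = \sum_i c i * A i k.
  by apply: eq_bigr => i _; rewrite sA.
by ring.
Qed.

Lemma eq_psd A B : (forall i j, A i j = B i j) -> psd A -> psd B.
Proof. by move=> AB; rewrite (_ : A = B)//; apply/funext => i; apply/funext. Qed.

Lemma psd0 : psd (fun _ _ => 0).
Proof.
split=> // c; rewrite /qform big1// => i _.
by rewrite big1 ?mulr0// => j _; rewrite mulr0.
Qed.

Lemma psdD A B : psd A -> psd B -> psd (fun i j => A i j + B i j).
Proof.
move=> [sA pA] [sB pB]; split=> [i j|c]; first by rewrite sA sB.
rewrite /qform; under eq_bigr => i _.
  under eq_bigr do rewrite mulrDr.
  rewrite big_split mulrDr; over.
by rewrite big_split; apply: addr_ge0; [exact: pA|exact: pB].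
Qed.

Lemma psd_congr a B : psd B -> psd (fun i j => a i * a j * B i j).
Proof.
move=> [sB pB]; split=> [i j|c]; first by rewrite sB [a i * _]mulrC.
have := pB (fun i => c i * a i); congr (_ <= _); apply: eq_bigr => i _.
by rewrite -mulrA; congr (_ * _); rewrite mulr_sumr; apply: eq_bigr => j _; ring.
Qed.

Lemma psd_cst (s : R) : 0 <= s -> psd (fun _ _ => s).
Proof.
move=> s0; split=> // c; rewrite /qform -mulr_suml -mulr_suml mulrA -expr2.
by rewrite mulr_ge0// sqr_ge0.
Qed.

Lemma psdZ (s : R) A : 0 <= s -> psd A -> psd (fun i j => s * A i j).
Proof.
move=> s0 pA; apply: eq_psd (psd_congr (fun=> Num.sqrt s) pA) => i j.
by rewrite -expr2 sqr_sqrtr.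
Qed.

Lemma psd_diag_ge0 A k : psd A -> 0 <= A k k.
Proof.
move=> [sA pA]; have := pA (fun i => 0 + 1 * (i == k)%:R).
rewrite qform_shift// /qform !big1 ?mulr0 ?add0r ?expr1n ?mul1r// => i _;
  by rewrite mul0r.
Qed.

Lemma psd_diag_eq0 A : psd A -> (forall i, A i i = 0) -> forall i j, A i j = 0.
Proof.
move=> pA A0 i j; have [sA gA] := pA.
(* With a zero diagonal, the form at [e_i + s e_j] is linear in [s]; both signs of [s] then force
   the entry to vanish. *)
have H s : 0 <= 2 * s * A i j.
  have := gA (fun l => (0 + 1 * (l == i)%:R) + s * (l == j)%:R).
  rewrite qform_shift// qform_shift// sum_shift /qform !A0 !big1 => [|l _|l _|l _];
    by rewrite ?mul0r// !mulr0 !addr0 !add0r mul1r.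
by have := H 1; have := H (-1); lra.
Qed.

(** Schur complement: its form at [c] is the minimum of the form of [A] over shifts of coordinate
    [k], attained at the shift [- S / A k k] used below. *)
Lemma psd_peel A k : psd A -> 0 < A k k ->
  psd (fun i j => A i j - A i k * A j k / A k k).
Proof.
move=> [sA pA] Ak; split=> [i j|c]; first by rewrite sA [A i k * _]mulrC.
have := pA (fun i => c i + (- (\sum_i c i * A i k) / A k k) * (i == k)%:R).
rewrite qform_shift//; set S := \sum_i c i * A i k; congr (_ <= _).
rewrite /qform.
transitivity (\sum_i (c i * (\sum_j c j * A i j) - c i * A i k * (S / A k k))).
  rewrite big_split/= sumrN -mulr_suml -/S.
  by field; exact: lt0r_neq0.
apply: eq_bigr => i _; under [in RHS]eq_bigr do rewrite mulrBr.
rewrite sumrB mulrBr; congr (_ - _); rewrite -mulrA; congr (_ * _).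
by rewrite /S !mulr_suml mulr_sumr; apply: eq_bigr => j _; ring.
Qed.

(* Schur's theorem: symmetric elimination writes [A] as a sum of rank one
   kernels, and the product of [B] with a rank one kernel is a congruence. *)
Lemma psdM A B : psd A -> psd B -> psd (fun i j => A i j * B i j).
Proof.
move=> pA pB.
(* Induction on a bound [k] for the indices with nonzero diagonal entry: each step peels off the
   last such index, and a zero diagonal means a zero kernel. *)
suff H k A' : psd A' -> (forall i : 'I_n, (k <= i)%N -> A' i i = 0) ->
    psd (fun i j => A' i j * B i j).
  by apply: (H n) => // i; rewrite leqNgt ltn_ord.
elim: k A' => [|k IH] {pA}A pA A0.
  apply: eq_psd psd0 => i j; rewrite (psd_diag_eq0 pA) ?mul0r// => l.
  exact: A0.
have [nk|kn] := leqP n k.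
  by apply: IH => // i ki; have := leq_trans nk ki; rewrite leqNgt ltn_ord.
pose o := Ordinal kn; have := psd_diag_ge0 o pA.
rewrite le_eqVlt => /orP[/eqP Ao|Ao].
  apply: IH => // i; rewrite leq_eqVlt => /orP[/eqP ki|]; last exact: A0.
  by rewrite -(_ : o = i) //; apply: val_inj.
have pA' := psd_peel pA Ao.
have pV : psd (fun i j => A i o * A j o * ((A o o)^-1 * B i j)).
  by apply: psd_congr; apply: psdZ => //; rewrite invr_ge0 ltW.
apply: eq_psd (psdD (IH _ pA' _) pV) => [i j|i]; first by field; exact: lt0r_neq0.
rewrite leq_eqVlt => /orP[/eqP ki|ki].
  by rewrite -(_ : o = i); [field; exact: lt0r_neq0|apply: val_inj].
(* Past the pivot the diagonal entry was zero, so peeling leaves minus a square over [A o o], which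
   is also nonnegative. *)
apply/eqP; rewrite eq_le (psd_diag_ge0 i pA') andbT A0// sub0r oppr_le0.
by rewrite mulr_ge0 ?invr_ge0 ?(ltW Ao)// -expr2 sqr_ge0.
Qed.

Lemma psdX A k : psd A -> psd (fun i j => A i j ^+ k).
Proof.
move=> pA; elim: k => [|k IH].
  by apply: eq_psd (psd_cst ler01) => i j; rewrite expr0.
by apply: eq_psd (psdM pA IH) => i j; rewrite exprS.
Qed.

(** Each inequality on the form is a closed condition. The filter is arbitrary so as to cover both
    sequences and the one-sided limit at zero. *)
Lemma psd_cvg (T : Type) (F : set_system T) {FF : ProperFilter F}
    (u : T -> 'I_n -> 'I_n -> R) A :
  (\forall N \near F, psd (u N)) ->
  (forall i j, u N i j @[N --> F] --> A i j) -> psd A.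
Proof.
move=> pu uA; split=> [i j|c].
  have : u N j i @[N --> F] --> A i j.
    apply: cvg_trans (uA i j); apply: near_eq_cvg.
    by apply: filterS pu => N [sN _]; rewrite sN.
  by move=> /cvg_unique; apply => //; exact: uA.
apply: (@closed_cvg _ _ F _ (fun N => qform (u N) c) [set x : R | 0 <= x]).
- exact: closed_ge.
- by apply: filterS pu => N [_]; apply.
- rewrite /qform; apply: cvg_big => [|i _]; first exact: add_continuous.
  apply: cvgM; first exact: cvg_cst.
  apply: cvg_big => [|j _]; first exact: add_continuous.
  by apply: cvgM; [exact: cvg_cst|exact: uA].
Qed.

(** Partial sums of the geometric series are sums of Schur powers of [A]. *)
Lemma psd_geometric A : psd A -> (forall i j, `|A i j| < 1) ->
  psd (fun i j => (1 - A i j)^-1).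
Proof.
move=> pA A1.
apply: (@psd_cvg _ \oo _ (fun N i j => series (geometric 1 (A i j)) N)).
  apply: nearW => N; elim: N => [|N IH].
    by apply: eq_psd psd0 => i j; rewrite seriesEnat/= big_geq.
  apply: eq_psd (psdD IH (psdX N pA)) => i j.
  by rewrite seriesEnat/= big_nat_recr//= mul1r.
by move=> i j; rewrite -[X in _ --> X]mul1r; apply: cvg_geometric_series; exact: A1.
Qed.

End PositiveSemidefinite.

(** * Hyperbolic functions and their normalised quotients *)

Section Hyperbolic.
Context {R : realType}.
Implicit Types s t x y : R.

Definition cosh t : R := (expR t + expR (- t)) / 2.
Definition sinh t : R := (expR t - expR (- t)) / 2.

Definition sinhc t : R := if t == 0 then 1 else sinh t / t.

(** Dividing [sinhc] by [cosh], instead of [tanh] by [t], avoids a separate case at zero. *)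
Definition tanhc t : R := sinhc t / cosh t.

Lemma coshN t : cosh (- t) = cosh t.
Proof. by rewrite /cosh opprK addrC. Qed.

Lemma sinhN t : sinh (- t) = - sinh t.
Proof. by rewrite /sinh opprK; field. Qed.

Lemma cosh0 : cosh 0 = 1.
Proof. by rewrite /cosh oppr0 expR0; field. Qed.

Lemma cosh_ge1 t : 1 <= cosh t.
Proof. by have := expR_ge1Dx t; have := expR_ge1Dx (- t); rewrite /cosh; lra. Qed.

Lemma cosh_gt0 t : 0 < cosh t.
Proof. exact: lt_le_trans ltr01 (cosh_ge1 t). Qed.

Lemma coshB x y : cosh (x - y) = cosh x * cosh y - sinh x * sinh y.
Proof. by rewrite /cosh /sinh opprB !expRD; field. Qed.

Lemma sinhD x y : sinh (x + y) = sinh x * cosh y + cosh x * sinh y.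
Proof. by rewrite /cosh /sinh opprD !expRD; field. Qed.

Lemma sinhB x y : sinh (x - y) = sinh x * cosh y - cosh x * sinh y.
Proof. by rewrite sinhD coshN sinhN mulrN. Qed.

Lemma ltr_norm_sinh_cosh t : `|sinh t| < cosh t.
Proof.
have := expR_gt0 t; have := expR_gt0 (- t).
by rewrite ltr_norml /sinh /cosh => ? ?; apply/andP; split; lra.
Qed.

Lemma sinhcE t : t * sinhc t = sinh t.
Proof.
rewrite /sinhc; case: eqVneq => [->|t0]; last by field.
by rewrite /sinh oppr0 subrr !mul0r.
Qed.

Lemma sinhc0 : sinhc 0 = 1.
Proof. by rewrite /sinhc eqxx. Qed.

Lemma sinhcN t : sinhc (- t) = sinhc t.
Proof. by rewrite /sinhc oppr_eq0 sinhN invrN mulrNN. Qed.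

Lemma sinhc_gt0 t : 0 < sinhc t.
Proof.
wlog t0 : t / 0 <= t => [H|].
  by have [/H//|/ltW t0] := leP 0 t; rewrite -sinhcN H// oppr_ge0.
rewrite /sinhc; case: eqVneq => // tn0; have {tn0}t0 : 0 < t by rewrite lt0r tn0.
by rewrite !divr_gt0// subr_gt0 ltr_expR; lra.
Qed.

Lemma sinhc_neq0 t : sinhc t != 0.
Proof. exact: lt0r_neq0 (sinhc_gt0 t). Qed.

Lemma cosh_neq0 t : cosh t != 0.
Proof. exact: lt0r_neq0 (cosh_gt0 t). Qed.

Lemma tanhc_neq0 t : tanhc t != 0.
Proof. by rewrite mulf_neq0 ?invr_eq0 ?sinhc_neq0 ?cosh_neq0. Qed.

Lemma tanhc0 : tanhc 0 = 1.
Proof. by rewrite /tanhc sinhc0 cosh0 divr1. Qed.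

Lemma continuous_expRN : continuous (fun t => expR (- t)).
Proof.
move=> t; apply: (@continuous_comp _ _ _ -%R expR); first exact: opp_continuous.
exact: continuous_expR.
Qed.

Lemma continuous_cosh : continuous cosh.
Proof.
move=> t; apply: cvgM; last exact: cvg_cst.
by apply: cvgD; [exact: continuous_expR|exact: continuous_expRN].
Qed.

Lemma continuous_sinh : continuous sinh.
Proof.
move=> t; apply: cvgM; last exact: cvg_cst.
by apply: cvgB; [exact: continuous_expR|exact: continuous_expRN].
Qed.

Lemma continuous_sinhc : continuous sinhc.
Proof.
move=> t; have [->|t0] := eqVneq t 0; last first.
  have : (fun s => sinh s / s) s @[s --> t] --> sinh t / t.
    by apply: cvgM; [exact: continuous_sinh|exact: cvgV].
  rewrite /continuous_at {2}/sinhc (negPf t0); apply: cvg_trans.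
  apply: near_eq_cvg; near=> s; rewrite /sinhc ifF//; apply/negbTE.
  near: s; exact: (cvgr_neq0 t).
(* Near zero [sinhc] is the difference quotient of [sinh], whose derivative there is 1. *)
apply/continuous_withinNx; rewrite sinhc0.
have D : is_derive (0 : R) 1 sinh 1.
  rewrite /sinh; apply: is_derive_eq.
  by rewrite oppr0 expR0 /GRing.scale/=; field.
have : h^-1 *: ((sinh \o shift 0) (h *: 1) - sinh 0) @[h --> 0^'] --> (1 : R).
  by rewrite -[X in _ --> X](@derive_val _ _ _ _ _ _ _ D); exact: ex_derive.
apply: cvg_trans; apply: near_eq_cvg; near=> h.
rewrite /sinhc ifF; last by apply/negbTE; near: h; exact: nbhs_dnbhs_neq.
rewrite /= addr0 /GRing.scale/= mulr1 [sinh 0]/sinh oppr0 subrr mul0r subr0.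
by rewrite mulrC.
Unshelve. all: by end_near. Qed.
Lemma continuous_tanhc : continuous tanhc.
Proof.
move=> t; apply: cvgM; first exact: continuous_sinhc.
by apply: cvgV; [exact: cosh_neq0|exact: continuous_cosh].
Qed.

End Hyperbolic.

(** * Positive definite functions and the ratios of [sinhc] and [tanhc] *)

Section PositiveDefinite.
Context {R : realType}.
Implicit Types (f g : R -> R) (a b t : R).

(** Continuity is left out because pointwise limits need not preserve it. *)
Definition pd f : Prop :=
  forall n (t : 'I_n -> R), psd (fun i j => f (t i - t j)).

Lemma eq_pd f g : f =1 g -> pd f -> pd g.
Proof. by move=> fg pf n t; apply: eq_psd (pf n t) => i j; rewrite fg. Qed.

Lemma pdM f g : pd f -> pd g -> pd (fun t => f t * g t).
Proof. by move=> pf pg n t; exact: psdM. Qed.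

Lemma pdZ a f : 0 <= a -> pd f -> pd (fun t => a * f t).
Proof. by move=> a0 pf n t; exact: psdZ. Qed.

Lemma pdD f g : pd f -> pd g -> pd (fun t => f t + g t).
Proof. by move=> pf pg n t; exact: psdD. Qed.

Lemma pd_cst a : 0 <= a -> pd (fun=> a).
Proof. by move=> a0 n t; exact: psd_cst. Qed.

Lemma pd_dilate a f : pd f -> pd (fun t => f (a * t)).
Proof.
move=> pf n t; apply: eq_psd (pf n (fun i => a * t i)) => i j.
by rewrite mulrBr.
Qed.

Lemma pd_geometric f : pd f -> (forall t, `|f t| < 1) ->
  pd (fun t => (1 - f t)^-1).
Proof. by move=> pf f1 n t; exact: psd_geometric. Qed.

Lemma pd_cvg (T : Type) (F : set_system T) {FF : ProperFilter F}
    (u : T -> R -> R) f :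
  (\forall N \near F, pd (u N)) ->
  (forall t, u N t @[N --> F] --> f t) -> pd f.
Proof.
move=> pu uf n t; apply: (@psd_cvg _ _ _ F _ (fun N i j => u N (t i - t j))) => //.
by apply: filterS pu => N pN; exact: pN.
Qed.

Lemma continuous_comp_mulr f t :
  continuous f -> continuous (fun a => f (a * t)).
Proof.
move=> cf a; apply: (@continuous_comp _ _ _ (fun a => a * t) f); last exact: cf.
exact: mulrr_continuous.
Qed.

Lemma continuous_comp_mull a f :
  continuous f -> continuous (fun t => f (a * t)).
Proof. by move=> cf; under eq_fun do rewrite mulrC; exact: continuous_comp_mulr. Qed.

Lemma pd_positive_definite f : continuous f -> pd f -> positive_definite f.
Proof.
move=> cf pf; split=> // n t; have [sf qf] := pf n t; split.
  by apply/matrixP => i j; rewrite !mxE sf.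
move=> v; have := qf (fun i => v i ord0); congr (_ <= _).
rewrite mxE; apply: eq_bigr => i _; rewrite mxE mulrC; congr (_ * _).
by apply: eq_bigr => j _; rewrite !mxE sf.
Qed.

(* [cosh x cosh y - sinh x sinh y] is, up to a congruence, one minus a kernel
   of rank one and norm less than one. *)
Lemma pd_inv_cosh : pd (fun t => (cosh t)^-1).
Proof.
move=> n t; pose th i := sinh (t i) / cosh (t i).
have th1 i : `|th i| < 1.
  by rewrite normf_div (ger0_norm (ltW (cosh_gt0 _))) ltr_pdivrMr ?cosh_gt0//
    mul1r ltr_norm_sinh_cosh.
have pth : psd (fun i j => th i * th j).
  by apply: eq_psd (psd_congr th (psd_cst ler01)) => i j; rewrite mulr1.
have pg := psd_congr (fun i => (cosh (t i))^-1) (psd_geometric pth _).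
apply: eq_psd (pg _) => [i j|i j]; last first.
  rewrite normrM; have [-> |h0] := eqVneq `|th j| 0; first by rewrite mulr0.
  by apply: lt_trans (th1 j); rewrite gtr_pMl// lt_neqAle eq_sym h0/=.
rewrite coshB -2!invfM /th; congr (_^-1).
by field; rewrite !cosh_neq0.
Qed.

(** This is [sinh (n t) / t] with its singularity at zero removed, so its ratios are those of
    [sinh (n t)]. *)
Definition nsinhc n t : R := n%:R * sinhc (n%:R * t).

(** Chebyshev recurrence, from [sinh (x + t) + sinh (x - t) = 2 sinh x cosh t] at
    [x = (n + 1) t]. *)
Lemma nsinhcSS n t :
  nsinhc n.+2 t = 2 * cosh t * nsinhc n.+1 t - nsinhc n t.
Proof.
rewrite /nsinhc; have [->|t0] := eqVneq t 0.
  by rewrite !mulr0 sinhc0 cosh0 -!natr1; ring.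
apply: (mulfI t0); rewrite mulrBr [in RHS]mulrCA !(mulrA t) ![t * _%:R]mulrC.
rewrite !sinhcE; set x := n.+1%:R * t.
have -> : n.+2%:R * t = x + t by rewrite /x -!natr1; ring.
have -> : n%:R * t = x - t by rewrite /x -!natr1; ring.
by rewrite sinhD sinhB; ring.
Qed.

Lemma nsinhc_gt0 n t : (0 < n)%N -> 0 < nsinhc n t.
Proof. by move=> n0; rewrite mulr_gt0 ?ltr0n// sinhc_gt0. Qed.

Lemma nsinhc_neq0 n t : (0 < n)%N -> nsinhc n t != 0.
Proof. by move=> n0; rewrite lt0r_neq0// nsinhc_gt0. Qed.

(** Since [2 cosh t >= 2], the recurrence makes the increments nondecreasing in [n], and the first
    one is positive. *)
Lemma nsinhc_le n t : nsinhc n t <= nsinhc n.+1 t.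
Proof.
elim: n => [|n IH]; first by rewrite /nsinhc mul0r ltW// nsinhc_gt0.
rewrite nsinhcSS lerBrDr; apply: le_trans (_ : 2 * nsinhc n.+1 t <= _).
  by rewrite mulr_natl mulr2n lerD2l.
rewrite ler_pM2r ?nsinhc_gt0//; have := cosh_ge1 t; lra.
Qed.

(* The recurrence gives the continued fraction
   [r_(n+1) = 1 / (2 cosh - r_n)], expanded as a geometric series. *)
Lemma pd_nsinhc_ratioS n : pd (fun t => nsinhc n t / nsinhc n.+1 t).
Proof.
elim: n => [|n IH].
  by apply: eq_pd (pd_cst (lexx 0)) => t; rewrite /nsinhc !mul0r.
have pc : pd (fun t => 2^-1 * (cosh t)^-1).
  by apply: pdZ pd_inv_cosh; rewrite invr_ge0.
apply: eq_pd (pdM pc (pd_geometric (pdM pc IH) _)) => t.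
  have := nsinhc_neq0 t (ltn0Sn n.+1); rewrite nsinhcSS => nz.
  have := nsinhc_neq0 t (ltn0Sn n) => nz'.
  by field; rewrite nz nz' cosh_neq0.
(* The series converges because the previous ratio is at most 1, while [2 cosh t] is at least 2. *)
have c1 := cosh_ge1 t.
have n0 : 0 <= nsinhc n t by rewrite mulr_ge0// ltW// sinhc_gt0.
have r1 : nsinhc n t / nsinhc n.+1 t <= 1.
  by rewrite ler_pdivrMr ?nsinhc_gt0// mul1r nsinhc_le.
have r0 : 0 <= nsinhc n t / nsinhc n.+1 t by rewrite divr_ge0// ltW// nsinhc_gt0.
rewrite ger0_norm; last by rewrite mulr_ge0// divr_ge0// ltW// cosh_gt0.
rewrite -invfM mulrC ltr_pdivrMr; last by rewrite mulr_gt0 ?cosh_gt0.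
by rewrite mul1r; lra.
Qed.

(** Telescoping product of consecutive ratios. *)
Lemma pd_nsinhc_ratio m n : (0 < m <= n)%N ->
  pd (fun t => nsinhc m t / nsinhc n t).
Proof.
move=> /andP[m0]; elim: n => [|n IH]; first by rewrite leqNgt m0.
rewrite leq_eqVlt => /orP[/eqP->|].
  by apply: eq_pd (pd_cst ler01) => t; rewrite divff// nsinhc_neq0.
rewrite ltnS => mn; apply: eq_pd (pdM (IH mn) (pd_nsinhc_ratioS n)) => t.
by field; rewrite !nsinhc_neq0// (leq_trans m0 mn).
Qed.

Lemma pd_sinhc_ratio a b : 0 <= a <= b ->
  pd (fun t => sinhc (a * t) / sinhc (b * t)).
Proof.
move=> /andP[a0]; rewrite le_eqVlt => /orP[/eqP->|ab].
  by apply: eq_pd (pd_cst ler01) => t; rewrite divff// sinhc_neq0.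
have b0 : 0 < b by exact: le_lt_trans ab.
(* Approximate [a / b] by fractions with denominator [N + 1]. Rounding up past the floor keeps the
   numerator positive even for [a = 0], and [a < b] keeps it at most [N + 1]. *)
pose m N := (Num.truncn (a / b * N.+1%:R)).+1.
pose r N : R := (m N)%:R / N.+1%:R.
have ab0 N : 0 <= a / b * N.+1%:R by rewrite mulr_ge0// divr_ge0// ltW.
have mN N : (0 < m N <= N.+1)%N.
  rewrite /= -(ltr_nat R); apply: le_lt_trans (_ : a / b * N.+1%:R < _).
    by rewrite truncn_le.
  by rewrite gtr_pMl// ltr_pdivrMr// mul1r.
have rab : r N @[N --> \oo] --> a / b.
  apply: (@squeeze_cvgr _ _ _ _ (fun=> a / b) (fun N => a / b + harmonic N)).
  - apply: nearW => N; have /andP[h1 h2] := truncn_itv (ab0 N).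
    rewrite /r ler_pdivlMr// (ltW h2)/= /harmonic/= ler_pdivrMr// mulrDl mulVf//.
    by rewrite /m -natr1 lerD2r.
  - exact: cvg_cst.
  - rewrite -[X in _ --> X]addr0.
    by apply: cvgD; [exact: cvg_cst|exact: cvg_harmonic].
apply: (@pd_cvg _ \oo _ (fun N t => sinhc (r N * b * t) / sinhc (b * t))).
  apply: nearW => N; have /andP[m0 _] := mN N.
  have r0 : 0 <= (r N)^-1 by rewrite invr_ge0 divr_ge0.
  apply: eq_pd (pdZ r0 (pd_dilate (b / N.+1%:R) (pd_nsinhc_ratio (mN N)))) => t.
  rewrite /nsinhc.
  have -> : (m N)%:R * (b / N.+1%:R * t) = r N * b * t by rewrite /r; field.
  have -> : N.+1%:R * (b / N.+1%:R * t) = b * t by field.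
  by rewrite /r; field; rewrite sinhc_neq0 nat1r !pnatr_eq0.
move=> t; apply: cvgM; last exact: cvg_cst.
have -> : a * t = (a / b) * (b * t) by field; exact: lt0r_neq0.
under eq_fun do rewrite -mulrA.
apply: (@cvg_comp _ _ _ r (fun s => sinhc (s * (b * t))) _ _ _ rab).
exact: continuous_comp_mulr continuous_sinhc _.
Qed.

(* [tanh (b t) / tanh (a t) = 1 + sinh ((b - a) t) / (sinh (a t) cosh (b t))],
   and [b - a <= a] makes [pd_sinhc_ratio] applicable. *)
Lemma pd_tanhc_ratio_le2 a b : 0 < a -> a <= b <= 2 * a ->
  pd (fun t => tanhc (b * t) / tanhc (a * t)).
Proof.
move=> a0 /andP[ab b2a]; have b0 : 0 < b by exact: lt_le_trans ab.
have p1 : pd (fun t => sinhc ((b - a) * t) / sinhc (a * t)).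
  by apply: pd_sinhc_ratio; apply/andP; split; lra.
have p2 := pdM p1 (pd_dilate b pd_inv_cosh).
have s0 : 0 <= (b - a) / a by rewrite divr_ge0 ?subr_ge0// ltW.
have q0 : 0 <= a / b by rewrite divr_ge0// ltW.
apply: eq_pd (pdZ q0 (pdD (pd_cst ler01) (pdZ s0 p2))) => t.
(* The subtraction formula for [sinh], divided by [t]. *)
have E : (b - a) * sinhc ((b - a) * t) =
    b * sinhc (b * t) * cosh (a * t) - a * sinhc (a * t) * cosh (b * t).
  have [->|t0] := eqVneq t 0; first by rewrite !mulr0 cosh0 sinhc0; ring.
  apply: (mulfI t0); rewrite mulrA [t * _]mulrC sinhcE mulrBl sinhB -!sinhcE; ring.
have := cosh_neq0 (b * t); have := cosh_neq0 (a * t).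
have := sinhc_neq0 (a * t); have := lt0r_neq0 a0; have := lt0r_neq0 b0.
move=> b1 a1 h1 h2 h3; rewrite /tanhc.
transitivity (a / b * (1 + (b - a) * sinhc ((b - a) * t) /
    (a * sinhc (a * t) * cosh (b * t)))).
  by field; rewrite b1 a1 h1 h3.
by rewrite E; field; rewrite b1 a1 h1 h2 h3.
Qed.

(** Factor the ratio through [2 * a] until [b] is within a factor of two. *)
Lemma pd_tanhc_ratio_gt0 a b : 0 < a -> a <= b ->
  pd (fun t => tanhc (b * t) / tanhc (a * t)).
Proof.
move=> a0 ab; have [k] : exists k, b <= 2 ^+ k * a.
  exists (Num.truncn (b / a)).+1; rewrite -ler_pdivrMr//.
  apply: le_trans (ltW (truncnS_gt _)) _.
  by rewrite -natrX ler_nat ltnW// ltn_expl.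
elim: k a a0 ab => [|k IH] a a0 ab bk.
  by apply: pd_tanhc_ratio_le2 => //; apply/andP; split; lra.
have [b2a|b2a] := leP b (2 * a).
  by apply: pd_tanhc_ratio_le2 => //; rewrite ab.
have p1 : pd (fun t => tanhc (b * t) / tanhc (2 * a * t)).
  by apply: IH; [lra|lra|rewrite mulrA -exprSr].
have p2 : pd (fun t => tanhc (2 * a * t) / tanhc (a * t)).
  by apply: pd_tanhc_ratio_le2 => //; apply/andP; split; lra.
apply: eq_pd (pdM p1 p2) => t; rewrite mulrA divfK//.
exact: tanhc_neq0.
Qed.

Lemma pd_tanhc_ratio a b : 0 <= a < b ->
  pd (fun t => tanhc (b * t) / tanhc (a * t)).
Proof.
move=> /andP[]; rewrite le_eqVlt => /orP[/eqP<- b0|a0 ab]; last first.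
  by apply: pd_tanhc_ratio_gt0 => //; exact: ltW.
(* For [a = 0], replace it by [e > 0] with [e <= b] and let [e] tend to zero. *)
apply: (@pd_cvg _ (0 : R)^'+ _ (fun a t => tanhc (b * t) / tanhc (a * t))).
  near=> e; apply: pd_tanhc_ratio_gt0; first by near: e; exact: nbhs_right_gt.
  by near: e; exact: nbhs_right_le.
move=> t; apply: cvgM; first exact: cvg_cst.
apply: cvgV; first exact: tanhc_neq0.
apply: cvg_at_right_filter.
exact: continuous_comp_mulr continuous_tanhc _.
Unshelve. all: by end_near. Qed.

End PositiveDefinite.

(** * The means at [(e^t, 1)] and the comparison of their quotients *)

Section Means.
Context {R : realType}.
Implicit Types a b t : R.

(** The logarithmic mean, taken through [mean_G 0] so that its value at [t = 0] is 1; [log_mean 1 1]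
    would be [0 / 0 = 0]. *)
Local Notation L := (fun t => mean_G 0 (expR t) 1).

Lemma expR_eq1 t : (expR t == 1) = (t == 0).
Proof. by rewrite -[in LHS]expR0 (inj_eq (@expR_inj R)). Qed.

Lemma log_mean_expR t : t != 0 -> mean_G 0 (expR t) 1 = (expR t - 1) / t.
Proof.
by move=> t0; rewrite /mean_G expR_eq1 (negPf t0) eqxx /log_mean expRK ln1 subr0.
Qed.

Lemma log_mean_expR_neq0 t : mean_G 0 (expR t) 1 != 0.
Proof.
have [->|t0] := eqVneq t 0; first by rewrite /mean_G expR0 eqxx oner_neq0.
by rewrite log_mean_expR// mulf_neq0 ?invr_eq0// subr_eq0 expR_eq1.
Qed.

Lemma powR_expR a t : expR t `^ a = expR (a * t).
Proof. by rewrite -expRM mulrC. Qed.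

Lemma expR_half a t : expR (a * t) = expR (a / 2 * t) * expR (a / 2 * t).
Proof. by rewrite -expRD; congr expR; field. Qed.

(** This and the next identity turn [e^(2t) - 1] and [e^(2t) + 1] into hyperbolic factors; the
    exponentials then cancel in the means. *)
Lemma expR_sinhc t : expR t * (2 * (t * sinhc t)) = expR t * expR t - 1.
Proof.
by rewrite sinhcE /sinh expRN; field; rewrite gt_eqF// expR_gt0.
Qed.

Lemma expR_cosh t : expR t * (2 * cosh t) = expR t * expR t + 1.
Proof. by rewrite /cosh expRN; field; rewrite gt_eqF// expR_gt0. Qed.

Lemma mean_G_expR a t : mean_G a (expR t) 1 = L t / sinhc (a / 2 * t).
Proof.
have [->|t0] := eqVneq t 0.
  by rewrite /mean_G expR0 eqxx mulr0 sinhc0 divr1.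
have [->|a0] := eqVneq a 0; first by rewrite !mul0r sinhc0 divr1.
rewrite log_mean_expR// /mean_G expR_eq1 (negPf t0) (negPf a0) mulr1 powR1.
rewrite !powR_expR (expR_half a) -expR_sinhc; set s := a / 2 * t.
have -> : 2 * (s * sinhc s) = a * t * sinhc s by rewrite /s; field.
by field; rewrite a0 t0 sinhc_neq0 gt_eqF// expR_gt0.
Qed.

Lemma mean_H_expR a t : mean_H a (expR t) 1 = L t / sinhc (a * t).
Proof.
have [->|t0] := eqVneq t 0.
  by rewrite /mean_H /mean_G expR0 eqxx mulr0 sinhc0 divr1.
have [->|a0] := eqVneq a 0.
  by rewrite !mul0r sinhc0 divr1 /mean_H /mean_G eqxx.
rewrite log_mean_expR// /mean_H expR_eq1 (negPf t0) (negPf a0) mulr1 powR1.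
rewrite !powR_expR; set P := expR (a * t); have P0 : 0 < P := expR_gt0 _.
(* Merging [(P + 1) (P - 1)] into [P * P - 1] produces [sinhc] at the full argument [a t], not at
   half of it. *)
have -> : 2 * a * P / (P + 1) * ((expR t - 1) / (P - 1)) =
    2 * a * P * (expR t - 1) / (P * P - 1).
  rewrite [_ / _ * _]mulf_div; congr (_ / _); ring.
rewrite -expR_sinhc -/P.
by field; rewrite a0 t0 sinhc_neq0 gt_eqF.
Qed.

Lemma mean_A_expR a t : mean_A a (expR t) 1 = L t / tanhc (a / 2 * t).
Proof.
have [->|t0] := eqVneq t 0.
  by rewrite /mean_A /mean_G expR0 eqxx mulr0 tanhc0 divr1.
have [->|a0] := eqVneq a 0.
  by rewrite !mul0r tanhc0 divr1 /mean_A /mean_G eqxx.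
rewrite log_mean_expR// /mean_A expR_eq1 (negPf t0) (negPf a0) powR1.
rewrite !powR_expR (expR_half a) -expR_sinhc -expR_cosh /tanhc; set s := a / 2 * t.
have -> : 2 * (s * sinhc s) = a * t * sinhc s by rewrite /s; field.
by field; rewrite a0 t0 sinhc_neq0 cosh_neq0 gt_eqF// expR_gt0.
Qed.

(** The common factor [L t] is nonzero and cancels, which turns the quotient of means into
    [g / f]. *)
Lemma mean_preceq_quotient (M N : R -> R -> R) (f g : R -> R) :
  continuous f -> continuous g ->
  (forall t, f t != 0) -> (forall t, g t != 0) ->
  (forall t, M (expR t) 1 = L t / f t) ->
  (forall t, N (expR t) 1 = L t / g t) ->
  pd (fun t => g t / f t) -> M ⪯ N.
Proof.
move=> cf cg f0 g0 ME NE p.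
rewrite /mean_preceq (_ : (fun t => _) = (fun t => g t / f t)).
  apply: pd_positive_definite p => t.
  by apply: cvgM; [exact: cg|apply: cvgV; [exact: f0|exact: cf]].
apply/funext => t; rewrite ME NE; field.
by rewrite f0 g0 log_mean_expR_neq0.
Qed.

End Means.

Theorem proposition2p3 (R : realType) :
  [/\ forall a b : R, 0 <= a -> a < b -> b <= 1 -> mean_H b ⪯ mean_H a,
      forall a b : R, 0 <= a -> a < b -> b <= 2 -> mean_G b ⪯ mean_G a
    & forall a b : R, 0 <= a -> a < b -> b <= 1 -> mean_A a ⪯ mean_A b].
Proof.
have cs c : continuous (fun t : R => sinhc (c * t)).
  exact/continuous_comp_mull/continuous_sinhc.
have ct c : continuous (fun t : R => tanhc (c * t)).
  exact/continuous_comp_mull/continuous_tanhc.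
split=> a b a0 ab _.
- apply: (mean_preceq_quotient (cs b) (cs a) _ _
    (mean_H_expR b) (mean_H_expR a)) => [t|t|].
  + exact: sinhc_neq0.
  + exact: sinhc_neq0.
  + by apply: pd_sinhc_ratio; rewrite a0 ltW.
- apply: (mean_preceq_quotient (cs (b / 2)) (cs (a / 2)) _ _
    (mean_G_expR b) (mean_G_expR a)) => [t|t|].
  + exact: sinhc_neq0.
  + exact: sinhc_neq0.
  + by apply: pd_sinhc_ratio; apply/andP; split; lra.
- apply: (mean_preceq_quotient (ct (a / 2)) (ct (b / 2)) _ _
    (mean_A_expR a) (mean_A_expR b)) => [t|t|].
  + exact: tanhc_neq0.
  + exact: tanhc_neq0.
  + by apply: pd_tanhc_ratio; apply/andP; split; lra.
Qed.
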